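(* Let $n \geq 1$ be an integer, let $B$ be a group acting on a set $X$ with finitely many orbits, let $G = \mathbb{Z}^n \wr_X B$, and let $D$ be the kernel of the action of $B$ on $X$. Assume that 1) every non-trivial conjugacy class in $B$ of an element of $D$ is non-abelian; 2) $B$ is a Hopfian group; 3) $\mathrm{Aut}(B)$ permutes $\{\mathrm{stab}_B(x)\}_{x\in X}$; 4) $[\mathrm{stab}_B(x) : \mathrm{stab}_B(x)\cap \mathrm{stab}_B(y)] = [\mathrm{stab}_B(y) : \mathrm{stab}_B(x)\cap \mathrm{stab}_B(y)]$ for all $x,y\in X$. Then $G$ is Hopfian.
   Context: All actions are left ones. For an abelian group $A$ and a group $B$ acting on a set $X$ (action written $b*x$), the combinatorial wreath product is $A \wr_X B = M \rtimes B$ with $M = AX = \bigoplus_{x\in X} Ax$, $Ax\simeq A$, and $b\left(\sum_x a_x x\right)b^{-1} = \sum_x a_x (b*x)$. $\mathrm{stab}_B(x)$ is the stabilizer of $x$ in $B$. ''$\mathrm{Aut}(B)$ permutes $\{\mathrm{stab}_B(x)\}_{x\in X}$'' means that every $\sigma \in \mathrm{Aut}(B)$ maps each point stabilizer $\mathrm{stab}_B(x)$, $x\in X$, onto a subgroup of the form $\mathrm{stab}_B(y)$, $y\in X$. A group is Hopfian if it has no proper quotient isomorphic to itself. A conjugacy class ${}^B b = \{gbg^{-1} \mid g\in B\}$ is non-trivial if $b\neq 1$, and non-abelian if it contains at least two elements that do not commute. The equality of indices in 4) does not force the indices to be finite, but if one is finite then the other is finite and equal to it. *)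

(* Defs.v *)
From HB Require Import structures.
From mathcomp Require Import all_boot all_order all_algebra finmap.
From mathcomp Require Import monalg.
From mathcomp Require Import boolp classical_sets functions cardinality.

Set Implicit Arguments.
Unset Strict Implicit.
Unset Printing Implicit Defensive.

Import GRing.Theory.

Local Open Scope classical_set_scope.
Local Open Scope quotient_scope.
Local Open Scope group_scope.

Definition isomorphic (G H : groupType) : Prop :=
  exists f : {multiplicative G -> H}, bijective f.

Record normalSubgroup (G : groupType) := NormalSubgroup {
  nsub_set :> set G;
  nsub1 : nsub_set 1;
  nsubM : forall u v, nsub_set u -> nsub_set v -> nsub_set (u * v);
  nsubV : forall u, nsub_set u -> nsub_set u^-1;
  nsubJ : forall g u, nsub_set u -> nsub_set (g * u * g^-1)
}.

Section QuotientGroup.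
Variables (G : groupType) (N : normalSubgroup G).

Definition cosetrel : rel G := fun g h => `[< nsub_set N (g^-1 * h) >].

Fact cosetrel_refl : reflexive cosetrel.
Proof. by move=> g; apply/asboolP; rewrite mulVg; exact: nsub1. Qed.

Fact cosetrel_sym : symmetric cosetrel.
Proof.
by move=> g h; apply/asboolP/asboolP => /nsubV; rewrite invgM invgK.
Qed.

Fact cosetrel_trans : transitive cosetrel.
Proof.
move=> h g k /asboolP Ngh /asboolP Nhk; apply/asboolP.
by have := nsubM Ngh Nhk; rewrite mulgA mulgK.
Qed.

Canonical cosetrel_equiv :=
  EquivRel cosetrel cosetrel_refl cosetrel_sym cosetrel_trans.

(* The quotient G/N, whose elements are the cosets gN. *)
Definition quotient_group : Type := {eq_quot cosetrel}.

HB.instance Definition _ := Choice.on quotient_group.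
HB.instance Definition _ := EqQuotient.on quotient_group.

Definition qone : quotient_group := \pi_quotient_group 1.
Definition qmul (a b : quotient_group) : quotient_group :=
  \pi_quotient_group (repr a * repr b).
Definition qinv (a : quotient_group) : quotient_group :=
  \pi_quotient_group (repr a)^-1.

Lemma qpiP g h :
  reflect (\pi_quotient_group g = \pi_quotient_group h) (cosetrel g h).
Proof. exact: eqquotP. Qed.

Lemma repr_cosetrel g : cosetrel (repr (\pi_quotient_group g)) g.
Proof. by apply/qpiP; rewrite reprK. Qed.

Lemma pi_qmul g h :
  qmul (\pi_quotient_group g) (\pi_quotient_group h) = \pi_quotient_group (g * h).
Proof.
apply/qpiP/asboolP.
have /asboolP Ng := repr_cosetrel g; have /asboolP Nh := repr_cosetrel h.
have := nsubM (nsubJ (repr (\pi_quotient_group h))^-1 Ng) Nh.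
by rewrite invgK !invgM !mulgA mulgK.
Qed.

Lemma pi_qinv g : qinv (\pi_quotient_group g) = \pi_quotient_group g^-1.
Proof.
apply/qpiP/asboolP; have := repr_cosetrel g; rewrite cosetrel_sym.
by move=> /asboolP /(nsubJ (repr (\pi_quotient_group g)));
  rewrite invgK !mulgA mulgK.
Qed.

Fact qmulA : associative qmul.
Proof.
move=> a b c; rewrite -[a]reprK -[b]reprK -[c]reprK.
rewrite (pi_qmul (repr a) (repr b)) (pi_qmul (repr b) (repr c)).
by rewrite (pi_qmul (repr a)) (pi_qmul (_ * _)) mulgA.
Qed.

Fact qmul1g : left_id qone qmul.
Proof. by move=> a; rewrite -[a]reprK pi_qmul mul1g. Qed.

Fact qmulg1 : right_id qone qmul.
Proof. by move=> a; rewrite -[a]reprK pi_qmul mulg1. Qed.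

Fact qmulVg : left_inverse qone qinv qmul.
Proof. by move=> a; rewrite -[a]reprK pi_qinv pi_qmul mulVg. Qed.

Fact qmulgV : right_inverse qone qinv qmul.
Proof. by move=> a; rewrite -[a]reprK pi_qinv pi_qmul mulgV. Qed.

HB.instance Definition _ :=
  isGroup.Build quotient_group qmulA qmul1g qmulg1 qmulVg qmulgV.

End QuotientGroup.

Definition hopfian (G : groupType) : Prop :=
  forall N : normalSubgroup G,
    isomorphic (quotient_group N) G -> N = [set 1] :> set G.

Definition is_left_action (B : groupType) (X : Type) (a : B -> X -> X) : Prop :=
  (forall x, a 1 x = x) /\ (forall b c x, a (b * c) x = a b (a c x)).

Record leftAction (B : groupType) (X : Type) := LeftAction {
  lact :> B -> X -> X;
  lactP : is_left_action lact
}.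

Section Actions.
Variables (B : groupType) (X : Type) (act : leftAction B X).

Lemma lact1 x : act 1 x = x.
Proof. exact: (lactP act).1. Qed.

Lemma lactM b c x : act (b * c) x = act b (act c x).
Proof. exact: (lactP act).2. Qed.

Lemma lactK b : cancel (act b) (act b^-1).
Proof. by move=> x; rewrite -lactM mulVg lact1. Qed.

Lemma lactKV b : cancel (act b^-1) (act b).
Proof. by move=> x; rewrite -lactM mulgV lact1. Qed.

Definition act_orbit (x : X) : set X := [set act b x | b in setT].

Definition finitely_many_orbits : Prop :=
  finite_set [set act_orbit x | x in setT].

Definition act_stab (x : X) : set B := [set b | act b x = x].

Definition act_kernel : set B := [set b | forall x, act b x = x].

End Actions.

(* {malg A[X]} is the group of finitely supported functions X -> A, that is,
   the direct sum of copies of A indexed by X; << a *g x >> is the element a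
   of the copy at x. *)
Section Wreath.
Variables (A : zmodType) (B : groupType) (X : choiceType).
Variable act : leftAction B X.

Definition malg_act (b : B) (m : {malg A[X]}) : {malg A[X]} :=
  (\sum_(x <- msupp m) << m@_x *g act b x >>)%R.

Lemma malg_actE b m x : (malg_act b m)@_x = m@_(act b^-1 x).
Proof.
rewrite /malg_act raddf_sum /=.
under eq_bigr => y _ do rewrite mcoeffU.
have [xm|xm] := boolP (act b^-1 x \in msupp m).
  rewrite (big_fsetD1 _ xm) /= lactKV eqxx mulr1n big1_fset ?addr0 // => y.
  rewrite in_fsetD1 => /andP[ny _] _; case: eqP => // E.
  by rewrite -E lactK eqxx in ny.
rewrite (mcoeff_outdom xm) big1_fset // => y ym _; case: eqP => // E.
by rewrite -E lactK ym in xm.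
Qed.

Lemma malg_act1 m : malg_act 1 m = m.
Proof. by apply/malgP => x; rewrite malg_actE invg1 lact1. Qed.

Lemma malg_actM b c m : malg_act (b * c) m = malg_act b (malg_act c m).
Proof. by apply/malgP => x; rewrite !malg_actE invgM lactM. Qed.

Lemma malg_actD b m p : malg_act b (m + p)%R = (malg_act b m + malg_act b p)%R.
Proof. by apply/malgP => x; rewrite mcoeffD !malg_actE mcoeffD. Qed.

Lemma malg_actN b m : malg_act b (- m)%R = (- malg_act b m)%R.
Proof. by apply/malgP => x; rewrite mcoeffN !malg_actE mcoeffN. Qed.

Lemma malg_act0 b : malg_act b 0%R = 0%R.
Proof. by apply/malgP => x; rewrite malg_actE !mcoeff0. Qed.

(* Wreath m b stands for the product m b of m in M and b in B.  The type does
   not mention act, but its group structure depends on act, whence the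
   parameter. *)
Record wreath (a : leftAction B X) := Wreath {
  wbase : {malg A[X]};
  wtop : B
}.

Definition wreath_pair (g : wreath act) : {malg A[X]} * B := (wbase g, wtop g).
Definition pair_wreath (p : {malg A[X]} * B) : wreath act := Wreath _ p.1 p.2.

Lemma wreath_pairK : cancel wreath_pair pair_wreath.
Proof. by case. Qed.

HB.instance Definition _ := Choice.copy (wreath act) (can_type wreath_pairK).

Definition wone : wreath act := Wreath _ 0%R 1.
Definition wmul (g h : wreath act) : wreath act :=
  Wreath _ (wbase g + malg_act (wtop g) (wbase h))%R (wtop g * wtop h).
Definition winv (g : wreath act) : wreath act :=
  Wreath _ (- malg_act (wtop g)^-1 (wbase g))%R (wtop g)^-1.

Fact wmulA : associative wmul.
Proof.
by move=> g h k; rewrite /wmul /= malg_actD malg_actM addrA mulgA.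
Qed.

Fact wmul1g : left_id wone wmul.
Proof. by case=> m b; rewrite /wmul /= malg_act1 add0r mul1g. Qed.

Fact wmulg1 : right_id wone wmul.
Proof. by case=> m b; rewrite /wmul /= malg_act0 addr0 mulg1. Qed.

Fact wmulVg : left_inverse wone winv wmul.
Proof. by case=> m b; rewrite /wmul /winv /= addNr mulVg. Qed.

Fact wmulgV : right_inverse wone winv wmul.
Proof.
case=> m b; rewrite /wmul /winv /= malg_actN -malg_actM.
by rewrite mulgV malg_act1 subrr.
Qed.

HB.instance Definition _ :=
  isGroup.Build (wreath act) wmulA wmul1g wmulg1 wmulVg wmulgV.

Lemma wreath_conjE (b : B) (m : {malg A[X]}) :
  Wreath act 0%R b * Wreath act m 1 * (Wreath act 0%R b)^-1
    = Wreath act (malg_act b m) 1.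
Proof.
suff : wmul (wmul (Wreath _ 0%R b) (Wreath _ m 1)) (winv (Wreath _ 0%R b))
       = Wreath _ (malg_act b m) 1 by [].
rewrite /wmul /winv /= malg_act0 oppr0 malg_act0 add0r addr0 mulg1.
by rewrite mulgV.
Qed.

End Wreath.

Arguments wreath A {B X} a.

Definition conj_class (B : groupType) (b : B) : set B :=
  [set g * b * g^-1 | g in setT].

Definition nonabelian_set (B : groupType) (C : set B) : Prop :=
  exists c d, [/\ C c, C d & ~ commute c d].

Definition aut_permutes_stabs (B : groupType) (X : Type)
    (act : leftAction B X) : Prop :=
  forall s : {multiplicative B -> B}, bijective s ->
  forall x, exists y, s @` act_stab act x = act_stab act y.

Definition left_cosets (B : groupType) (H K : set B) : set (set B) :=
  [set [set h * k | k in K] | h in H].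

(* The index [H : K] of a subgroup K of H; None encodes an infinite index. *)
Definition subgroup_index (B : groupType) (H K : set B) : option nat :=
  if pselect (finite_set (left_cosets H K))
  then Some #|` fset_set (left_cosets H K)| else None.

(* Main.v *)
Require Import Defs.
From HB Require Import structures.
From mathcomp Require Import all_boot all_order all_algebra finmap.
From mathcomp Require Import monalg zify ring.
From mathcomp Require Import boolp classical_sets functions cardinality.

(** Let phi be a surjective endomorphism of G = M : B.  Every element of phi(M)
    commutes with all its conjugates; commuting with its conjugates by M forces
    its B-component into the kernel D, and hypothesis 1) then kills it, so phi
    maps M into M.  As B is Hopfian, phi induces an automorphism sigma of B, and
    it remains to see that the surjective map T : M -> M induced by phi, which
    satisfies T (b m) = sigma(b) T m, is injective.  Regard T as an equivariant
    map from Z[X x n] to Z[Y x n], where Y is X with the action twisted by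
    sigma.

    By 3) and 4), |Stab(x) y| = |Stab(y) x| for x in X and y in Y.  So T has
    finite rows, its transpose T^t is again an operator between these modules,
    and the "trace" (the sum of one diagonal coefficient per orbit) satisfies
    tr (RS) = tr (SR).  With a bound C for T^t T, the operators P = C - T^t T
    and Q = C - T T^t then have powers of equal trace.  A nonzero v in ker T is
    fixed by (P/C)^2k, which bounds tr (P/C)^2k from below independently of k;
    on the other hand each basis vector of Y is some T w, and |(Q/C)^k T w|^2
    is O(1/k).  This is a contradiction. *)

Set Implicit Arguments.
Unset Strict Implicit.
Unset Printing Implicit Defensive.

Import Order.TTheory GRing.Theory Num.Theory.

Local Open Scope ring_scope.

(** * The inner product on a free module *)

Section FreeModule.
Variable X : choiceType.
Implicit Types u v w : {malg int[X]}.

Lemma additive_malgE (W : zmodType) (T : {additive {malg int[X]} -> W}) u :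
  T u = \sum_(x <- msupp u) T << 1 *g x >> *~ u@_x.
Proof.
rewrite {1}[u]monalgE raddf_sum; apply: eq_bigr => x _.
by rewrite -{1}[u@_x]intz !raddfMz.
Qed.

Lemma eq_additive_malg (W : zmodType) (S T : {additive {malg int[X]} -> W}) :
  (forall x, S << 1 *g x >> = T << 1 *g x >>) -> S =1 T.
Proof.
move=> E u; rewrite (additive_malgE S) (additive_malgE T).
by apply: eq_bigr => x _; rewrite E.
Qed.

(** The standard inner product; going through [mmap] makes additivity in [u] immediate. *)
Definition dot u v : int := mmap idfun (mcoeff^~ v) u.

Lemma dotEw (D : {fset X}) u v : (msupp u `<=` D)%fset ->
  dot u v = \sum_(x <- D) u@_x * v@_x.
Proof. exact: (@mmapEw _ _ _ idfun). Qed.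

Lemma dotC u v : dot u v = dot v u.
Proof.
rewrite (dotEw _ (fsubsetUl (msupp u) (msupp v))).
rewrite (dotEw _ (fsubsetUr (msupp u) (msupp v))).
by apply: eq_bigr => x _; rewrite mulrC.
Qed.

Lemma dotDl w : {morph dot^~ w : u v / u + v}.
Proof. by move=> u v; rewrite /dot mmapD. Qed.

Lemma dotNl w : {morph dot^~ w : u / - u}.
Proof. by move=> u; rewrite /dot mmapN. Qed.

Lemma dotMnl w n : {morph dot^~ w : u / u *+ n}.
Proof. by move=> u; rewrite /dot mmapMn. Qed.

Lemma dotDr w : {morph dot w : u v / u + v}.
Proof. by move=> u v; rewrite !(dotC w) dotDl. Qed.

Lemma dotNr w : {morph dot w : u / - u}.
Proof. by move=> u; rewrite !(dotC w) dotNl. Qed.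

HB.instance Definition _ u :=
  GRing.isZmodMorphism.Build {malg int[X]} int (dot u)
    (fun v w => etrans (dotDr u v (- w)) (congr1 (+%R _) (dotNr u w))).

Lemma dotUl x u : dot << 1 *g x >> u = u@_x.
Proof. by rewrite /dot mmapU mul1r. Qed.

Lemma dot_ge0 u : 0 <= dot u u.
Proof. by rewrite /dot mmapE sumr_ge0 // => x _; rewrite -expr2 sqr_ge0. Qed.

Lemma dot_gt0 u : u != 0 -> 0 < dot u u.
Proof.
move=> u0; have [x xu] : exists x, x \in msupp u.
  apply/fset0Pn; apply: contra_neq u0 => u0; apply/malgP => x.
  by rewrite mcoeff0 mcoeff_outdom // u0 in_fset0.
rewrite /dot mmapE (big_fsetD1 x) //=.
rewrite ltr_pwDl ?sumr_ge0 // => [|y _]; last by rewrite -expr2 sqr_ge0.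
by rewrite -expr2 exprn_even_gt0 //= mcoeff_neq0.
Qed.

(** For u nonzero, |(u.v) u - (u.u) v|^2 >= 0 is the claimed inequality multiplied by u.u > 0. *)
Lemma dot_CauchySchwarz u v : (dot u v) ^+ 2 <= dot u u * dot v v.
Proof.
have [->|u0] := eqVneq u 0; first by rewrite /dot !mmap0 mul0r expr0n.
have := dot_ge0 (u *~ dot u v - v *~ dot u u).
rewrite !(dotDl, dotDr, dotNl, dotNr).
have L w a b : dot (a *~ b) w = dot a w * b.
  by rewrite dotC raddfMz dotC -mulrzr intz.
have R w a b : dot w (a *~ b) = dot w a * b by rewrite dotC L dotC.
rewrite !L !R (dotC v u).
have := dot_gt0 u0; move: (dot u u) (dot u v) (dot v v) => a b c a0 H.
by nia.
Qed.

End FreeModule.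

(** * Positive operators *)

Definition norm1 (X : choiceType) (u : {malg int[X]}) : int :=
  \sum_(x <- msupp u) `|u@_x|.

Lemma norm1_ge (X : choiceType) (D : {fset X}) (u : {malg int[X]}) :
  \sum_(x <- D) `|u@_x| <= norm1 u.
Proof.
have -> : norm1 u = \sum_(x <- (D `|` msupp u)%fset) `|u@_x|.
  apply: big_fset_incl (fsubsetUr _ _) _ => x _ /mcoeff_outdom ->.
  by rewrite normr0.
have -> : \sum_(x <- D) `|u@_x| =
    \sum_(x <- (D `|` msupp u)%fset) if x \in D then `|u@_x| else 0.
  rewrite -(@big_fset_incl _ _ _ _ _ _ _ (fsubsetUl D (msupp u))).
    by apply: eq_big_seq => x ->.
  by move=> x _ /negPf ->.
by apply: ler_sum => x _; case: ifP.
Qed.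

(** An integral form of 1 - S/C, whence the powers of C in the estimates below. *)
Definition shifted (V : zmodType) (C : nat) (S : V -> V) (u : V) : V :=
  u *+ C - S u.

Lemma shiftedE (V : zmodType) C (S : V -> V) u : shifted C S u = u *+ C - S u.
Proof. by []. Qed.

Section Shifted.
Variables (V : zmodType) (C : nat) (S : {additive V -> V}).

Fact shifted_is_zmod_morphism : zmod_morphism (shifted C S).
Proof.
by move=> u v; rewrite /shifted raddfB mulrnBl !opprD !opprK addrACA.
Qed.

HB.instance Definition _ :=
  GRing.isZmodMorphism.Build V V (shifted C S) shifted_is_zmod_morphism.

End Shifted.

Section PositiveOperator.
Variables (X : choiceType) (C : nat).
Variable S : {additive {malg int[X]} -> {malg int[X]}}.
Hypothesis Sadj : forall u v, dot (S u) v = dot u (S v).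

(* Schur's test: 2 u_x u_y <= u_x^2 + u_y^2. *)
Lemma dot_le_norm1 (u : {malg int[X]}) :
  (forall x, norm1 (S << 1 *g x >>) <= C%:R) -> dot (S u) u <= dot u u *+ C.
Proof.
move=> SC; set D := msupp u; pose s x y := (S << 1 *g x >>)@_y.
have sC x y : s x y = s y x by rewrite /s -dotUl -Sadj dotC dotUl.
have Su x : (S u)@_x = \sum_(y <- D) s x y * u@_y.
  rewrite (additive_malgE S) raddf_sum; apply: eq_bigr => y _ /=.
  by rewrite raddfMz sC /s -mulrzr intz.
have -> : dot (S u) u = \sum_(x <- D) \sum_(y <- D) s x y * (u@_x * u@_y).
  rewrite dotC (@dotEw _ D) //; apply: eq_bigr => x _.
  by rewrite Su mulr_sumr; apply: eq_bigr => y _; ring.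
pose E := \sum_(x <- D) \sum_(y <- D) `|s x y| * u@_x ^+ 2.
have E' : E = \sum_(x <- D) \sum_(y <- D) `|s x y| * u@_y ^+ 2.
  rewrite /E exchange_big /=; apply: eq_bigr => x _; apply: eq_bigr => y _.
  by rewrite sC.
have EC : E <= dot u u *+ C.
  rewrite (@dotEw _ D) // -sumrMnl; apply: ler_sum => x _.
  rewrite -mulr_suml -mulr_natl -expr2 ler_wpM2r ?sqr_ge0 //.
  by apply: le_trans (SC x); apply: norm1_ge.
apply: le_trans EC; rewrite -(ler_pMn2r (n := 2)) //.
rewrite [E *+ 2]mulr2n {2}E' /E -big_split -sumrMnl; apply: ler_sum => x _.
rewrite -big_split -sumrMnl; apply: ler_sum => y _ /=.
have := normr_ge0 (s x y); have := ler_norm (s x y).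
have := ler_norm (- s x y).
rewrite normrN; move: (s x y) `|_| (u@_x) (u@_y) => a n b c h1 h2 h3.
rewrite -mulrDr -mulrnAr.
(* The sign of u_x u_y decides whether s_xy <= |s_xy| or -s_xy <= |s_xy| is used. *)
have [bc|/ltW bc] := leP 0 (b * c).
  apply: (@le_trans _ _ (n * (b * c *+ 2))).
    by rewrite ler_wpM2r // mulrn_wge0.
  by rewrite ler_wpM2l //; have := sqr_ge0 (b - c); nia.
apply: (@le_trans _ _ ((- n) * (b * c *+ 2))).
  by rewrite ler_wnM2r // ?mulrn_wle0 // lerNl.
by rewrite mulNr -mulrN ler_wpM2l //; have := sqr_ge0 (b + c); nia.
Qed.

Hypothesis S_le : forall u, dot (S u) u <= dot u u *+ C.
Let P : {malg int[X]} -> {malg int[X]} := shifted C S.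

Lemma dot_shifted u v : dot (P u) v = dot u v *+ C - dot (S u) v.
Proof. by rewrite /P /shifted dotDl dotNl dotMnl. Qed.

Lemma iter_shifted_adj k (u v : {malg int[X]}) : dot (iter k P u) v = dot u (iter k P v).
Proof.
elim: k u v => // k IH u v.
rewrite iterS iterSr dot_shifted Sadj -IH /P.
by rewrite /P -/P /shifted raddfB raddfMn.
Qed.

Lemma iter_shifted_comm k (u : {malg int[X]}) : iter k P (S u) = S (iter k P u).
Proof.
elim: k => //= k ->.
by rewrite /P /shifted raddfB raddfMn.
Qed.

Lemma iter_shifted_double k (u : {malg int[X]}) :
  dot (iter k.*2 P u) u = dot (iter k P u) (iter k P u).
Proof. by rewrite -addnn iterD iter_shifted_adj. Qed.

(** An even power gives a squared norm; for exponent 2j+1 the value is the product of P w with w =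
    P^j u, non-negative by [S_le]. *)
Lemma iter_shifted_ge0 k (u : {malg int[X]}) : 0 <= dot (iter k P u) u.
Proof.
rewrite -[k]odd_double_half; case: odd; last first.
  by rewrite iter_shifted_double dot_ge0.
rewrite add1n iterSr -addnn iterD iter_shifted_adj -iterSr iterS.
by rewrite dot_shifted subr_ge0.
Qed.

(* With S and P = C - S commuting and positive, t (C - t)^k <= C^(k+1) / k on
   [0, C] becomes a bound on S P^k. *)
Lemma dot_iter_shifted_le k (u : {malg int[X]}) :
  dot (S (iter k P u)) u *+ k <= dot u u *+ (C ^ k.+1).
Proof.
pose a j := dot (S (iter j P u)) u; pose d j := dot (iter j P u) u.
have dS j : d j.+1 = d j *+ C - a j by rewrite /d iterS dot_shifted.
(* The difference C a_j - a_(j+1) is the inner product of P^j (S u) with S u. *)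
have aS j : a j.+1 <= a j *+ C.
  rewrite /a iterS -subr_ge0 [P _]/(_ - _) raddfB raddfMn dotDl dotNl dotMnl.
  rewrite opprB addrC addrNK -iter_shifted_comm Sadj.
  by rewrite iter_shifted_ge0.
(* By [dS], C^k |u|^2 - d_k is the sum of C^(k-1-j) a_j over j < k, and by [aS] each C^(k-j) a_j is
   at least a_k. *)
suff H : a k *+ k <= (dot u u *+ (C ^ k) - d k) *+ C.
  apply: le_trans H _; rewrite mulrnBl -mulrnA -expnSr lerBlDr lerDl.
  by rewrite mulrn_wge0 ?iter_shifted_ge0.
elim: k => [|k IH]; first by rewrite mulr0n /d expn0 subrr mul0rn.
apply: (@le_trans _ _ (a k *+ C *+ k.+1)); first by rewrite lerMn2r aS orbT.
rewrite -mulrnA mulnC mulrnA lerMn2r mulrS dS expnSr mulrnA.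
apply/orP; right.
apply: (@le_trans _ _ (a k + (dot u u *+ C ^ k - d k) *+ C)).
  by rewrite lerD2l.
by rewrite mulrnBl opprB addrCA.
Qed.

End PositiveOperator.

(** * Mass transport *)

Section TwoActions.
Local Open Scope classical_set_scope.
Variables (B : groupType) (X Y : choiceType).
Variables (aX : leftAction B X) (aY : leftAction B Y).

Definition transversal (I : {fset X}) : Prop :=
  (forall x, exists2 i, i \in I & exists b, aX b i = x) /\
  {in I &, forall i j, (exists b, aX b i = j) -> i = j}.

(** Its cardinality is the index of Stab(x) ∩ Stab(y) in Stab(x), which is how hypothesis 4)
    enters. *)
Definition stab_orbit (x : X) (y : Y) : set Y :=
  [set aY b y | b in act_stab aX x].

Definition same_orbit2 (x : X) (y : Y) (x' : X) (y' : Y) : bool :=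
  `[< exists b, aX b x' = x /\ aY b y' = y >].

(** The stabilizer of b x is the conjugate by b of the stabilizer of x. *)
Lemma stab_orbitJ b x y : stab_orbit (aX b x) (aY b y) = aY b @` stab_orbit x y.
Proof.
apply/seteqP; split=> [_ [c cx <-]|_ [_ [c cx <-] <-]].
  exists (aY (b^-1 * c * b)%g y); last by rewrite -lactM !mulgA mulgV mul1g lactM.
  exists (b^-1 * c * b)%g => //; rewrite /act_stab /= !lactM.
  by have -> : aX c (aX b x) = aX b x by []; rewrite lactK.
exists (b * c * b^-1)%g; last by rewrite -!lactM mulgVK.
by rewrite /act_stab /= -!lactM mulgVK lactM cx.
Qed.

Lemma same_orbit2C x y x' y' : same_orbit2 x y x' y' = same_orbit2 x' y' x y.
Proof.
by apply/asbool_equiv_eq; split=> -[b [<- <-]]; exists b^-1%g; rewrite !lactK.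
Qed.

End TwoActions.

(** On an infinite orbit [fset_set] is empty and the value is 0, so finiteness has to be tracked
    separately. *)
Definition stab_orbit_card (B : groupType) (X Y : choiceType)
    (aX : leftAction B X) (aY : leftAction B Y) x y : nat :=
  #|` fset_set (stab_orbit aX aY x y)|.

Lemma card_eq_fset (T U : choiceType) (A : set T) (B : set U) :
  (A #= B)%card -> #|` fset_set A| = #|` fset_set B|.
Proof.
move=> AB; have [finA|infA] := pselect (finite_set A).
  by apply/fcard_eq => //; rewrite -(eq_finite_set AB).
rewrite /fset_set; case: pselect => // finA'; case: pselect => // finB.
by rewrite (eq_finite_set AB) in infA.
Qed.

Lemma stab_orbit_cardJ (B : groupType) (X Y : choiceType)
    (aX : leftAction B X) (aY : leftAction B Y) b x y :
  stab_orbit_card aX aY (aX b x) (aY b y) = stab_orbit_card aX aY x y.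
Proof.
apply: card_eq_fset; rewrite stab_orbitJ.
by apply: inj_card_eq => u v _ _; apply: (can_inj (lactK aY b)).
Qed.

Section CountRelated.
Local Open Scope classical_set_scope.
Variables (B : groupType) (X Y : choiceType).
Variables (aX : leftAction B X) (aY : leftAction B Y).

Lemma same_orbit2_swap x y x' y' :
  same_orbit2 aX aY x y x' y' = same_orbit2 aY aX y x y' x'.
Proof.
by apply/asbool_equiv_eq; split=> -[b [<- <-]]; exists b.
Qed.

(* The pairs over y0 in the orbit of (x, y) are those (x', y0) with x' in a
   translate of the orbit of x under the stabilizer of y. *)
Lemma sum_same_orbit2 (J : {fset Y}) (sY : Y -> {fset X}) x y :
  transversal aY J ->
  (forall x' y', same_orbit2 aX aY x y x' y' -> x' \in sY y') ->
  finite_set (stab_orbit aY aX y x) /\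
  (\sum_(y' <- J) \sum_(x' <- sY y') same_orbit2 aX aY x y x' y')%N =
    stab_orbit_card aY aX y x.
Proof.
move=> [Jex Juniq] sYP; have [y0 y0J [b by0]] := Jex y.
have finY : finite_set (stab_orbit aY aX y x).
  apply: (@sub_finite_set _ _ [set` sY y]); last exact: finite_fset.
  by move=> _ [c cy <-]; apply: sYP; apply/asboolP; exists c^-1%g;
     rewrite lactK -{1}[y]cy lactK.
split=> //.
(* Only the representative [y0] of the orbit of [y] contributes; moving [y] to [y0] takes [x] to the
   point [x0] below. *)
rewrite (big_fsetD1 y0) //= [X in (_ + X)%N]big1_fset ?addn0; last first.
  move=> y'; rewrite !inE => /andP[y'0 y'J] _; rewrite big1 // => x' _.
  rewrite /same_orbit2; case: asboolP => // -[c [_ cy']].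
  case/eqP: y'0; apply: Juniq => //; exists (b^-1 * c)%g.
  by rewrite lactM cy' -by0 lactK.
set x0 := aX b^-1%g x.
have xE : x = aX b x0 by rewrite /x0 lactKV.
rewrite -[in RHS]by0 {2}xE stab_orbit_cardJ /stab_orbit_card.
have rel x' : same_orbit2 aX aY x y x' y0 <-> stab_orbit aY aX y0 x0 x'.
  split=> [/asboolP[c [cx cy]]|[c cy <-]].
    exists (c^-1 * b)%g; last by rewrite lactM -xE -cx lactK.
    by rewrite /act_stab /= lactM by0 -cy lactK.
  apply/asboolP; exists (b * c^-1)%g.
  rewrite !lactM lactK -xE; split=> //.
  by rewrite -{1}cy lactK.
have fin0 : finite_set (stab_orbit aY aX y0 x0).
  apply: (@sub_finite_set _ _ [set` sY y0]); last exact: finite_fset.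
  by move=> x' /rel /sYP.
rewrite -sum1_size; apply: esym.
rewrite (eq_big_seq (fun x' => same_orbit2 aX aY x y x' y0 : nat)); last first.
  by move=> x'; rewrite in_fset_set // inE => /rel ->.
have sub : (fset_set (stab_orbit aY aX y0 x0) `<=` sY y0)%fset.
  by apply/fsubsetP => x'; rewrite in_fset_set // inE => /rel /sYP.
apply: (big_fset_incl _ sub) => x' _.
rewrite in_fset_set // => /negP x'N.
case: (boolP (same_orbit2 _ _ _ _ _ _)) => // /rel x'R.
by case: x'N; rewrite inE.
Qed.

End CountRelated.

(** The equality |Stab(x) y| = |Stab(y) x|, asked when the left side is finite; equipotence then
    makes the right side finite too. *)
Definition unimodular (B : groupType) (X Y : choiceType)
    (aX : leftAction B X) (aY : leftAction B Y) : Prop :=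
  forall x y, finite_set (stab_orbit aX aY x y) ->
    (stab_orbit aX aY x y #= stab_orbit aY aX y x)%card.

(* Weigh each pair (x, y) by f x y / N x y, where N x y is the common cardinality
   of the two stabilizer orbits, and count related pairs in two ways. *)
Lemma mass_transport (B : groupType) (X Y : choiceType)
    (aX : leftAction B X) (aY : leftAction B Y) (I : {fset X}) (J : {fset Y})
    (sX : X -> {fset Y}) (sY : Y -> {fset X}) (f : X -> Y -> int) :
  unimodular aX aY -> transversal aX I -> transversal aY J ->
  (forall b x y, f (aX b x) (aY b y) = f x y) ->
  (forall x y, f x y != 0 -> y \in sX x /\ x \in sY y) ->
  \sum_(x <- I) \sum_(y <- sX x) f x y = \sum_(y <- J) \sum_(x <- sY y) f x y.
Proof.
move=> uni IX JY finv fsupp.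
have fR x y x' y' : same_orbit2 aX aY x y x' y' -> f x y = f x' y'.
  by move=> /asboolP[b [<- <-]]; rewrite finv.
have sup x y x' y' : f x y != 0 -> same_orbit2 aX aY x y x' y' ->
    y' \in sX x' /\ x' \in sY y'.
  by move=> f0 /fR E; apply: fsupp; rewrite -E.
pose N x y := stab_orbit_card aY aX y x.
have NR x y x' y' : same_orbit2 aX aY x y x' y' -> N x y = N x' y'.
  by move=> /asboolP[b [<- <-]]; rewrite /N stab_orbit_cardJ.
have rowN x y : f x y != 0 ->
    (\sum_(y' <- J) \sum_(x' <- sY y') same_orbit2 aX aY x y x' y')%N = N x y.
  by move=> f0; apply: (sum_same_orbit2 JY _).2 => x' y' /sup[].
have colN x y : f x y != 0 ->
    (\sum_(x' <- I) \sum_(y' <- sX x') same_orbit2 aX aY x y x' y')%N = N x y.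
  move=> f0; have [fin1 E] : finite_set (stab_orbit aX aY x y) /\
     (\sum_(x' <- I) \sum_(y' <- sX x') same_orbit2 aY aX y x y' x')%N =
       stab_orbit_card aX aY x y.
    by apply: sum_same_orbit2 => // y' x'; rewrite -same_orbit2_swap => /sup[].
  (* Counting over [I] gives |Stab(x) y|, which unimodularity identifies with [N x y]. *)
  rewrite /N /stab_orbit_card -(card_eq_fset (uni _ _ fin1)) -[RHS]E.
  apply: eq_bigr => x' _; apply: eq_bigr => y' _.
  by rewrite same_orbit2_swap.
(* The translate of (x, y) lying over [J] is itself counted, so [N x y] is positive. *)
have N0 x y : f x y != 0 -> (N x y)%:R != 0 :> rat.
  move=> f0; rewrite -(rowN _ _ f0) pnatr_eq0 -lt0n.
  have [y' y'J [b by']] := JY.1 y.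
  have R : same_orbit2 aX aY x y (aX b^-1%g x) y'.
    by apply/asboolP; exists b; rewrite lactKV.
  rewrite (big_fsetD1 y') //= (big_fsetD1 (aX b^-1%g x)) ?(sup _ _ _ _ f0 R).2 //=.
  by rewrite R.
pose g x y : rat := (f x y)%:~R / (N x y)%:R.
apply: (@intr_inj rat); rewrite !raddf_sum /=.
transitivity (\sum_(x <- I) \sum_(y <- sX x) \sum_(y' <- J) \sum_(x' <- sY y')
    (same_orbit2 aX aY x y x' y')%:R * g x y).
  apply: eq_bigr => x _; rewrite raddf_sum; apply: eq_bigr => y _ /=.
  have [f0|f0] := eqVneq (f x y) 0.
    rewrite f0 big1 // => y' _; rewrite big1 // => x' _.
    by rewrite /g f0 mul0r mulr0.
  under eq_bigr do rewrite -mulr_suml -natr_sum.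
  by rewrite -mulr_suml -natr_sum rowN // /g mulrC divfK ?N0.
(* As [f] and [N] are constant on related pairs, the weight can move from (x, y) to (x', y') once
   the sums are exchanged. *)
transitivity (\sum_(y' <- J) \sum_(x' <- sY y') \sum_(x <- I) \sum_(y <- sX x)
    (same_orbit2 aX aY x' y' x y)%:R * g x' y').
  under eq_bigr do rewrite exchange_big /=.
  rewrite exchange_big /=; apply: eq_bigr => y' _.
  under eq_bigr do rewrite exchange_big /=.
  rewrite exchange_big /=; apply: eq_bigr => x' _.
  apply: eq_bigr => x _; apply: eq_bigr => y _.
  rewrite same_orbit2C.
  case: (boolP (same_orbit2 _ _ _ _ _ _)) => [R|_]; last by rewrite !mul0r.
  by rewrite /g (fR _ _ _ _ R) (NR _ _ _ _ R).
apply: eq_bigr => y _; rewrite raddf_sum; apply: eq_bigr => x _ /=.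
have [f0|f0] := eqVneq (f x y) 0.
  rewrite f0 big1 // => y' _; rewrite big1 // => x' _.
  by rewrite /g f0 mul0r mulr0.
under eq_bigr do rewrite -mulr_suml -natr_sum.
by rewrite -mulr_suml -natr_sum colN // /g mulrC divfK ?N0.
Qed.

(** * Equivariant operators, transposes and traces *)

Section LinearExtension.
Variables (Y : choiceType) (W : zmodType) (rho : Y -> W).

Definition linear_ext (w : {malg int[Y]}) : W :=
  \sum_(y <- msupp w) rho y *~ w@_y.

Lemma linear_extEw (D : {fset Y}) w : (msupp w `<=` D)%fset ->
  linear_ext w = \sum_(y <- D) rho y *~ w@_y.
Proof.
move=> sub; rewrite /linear_ext (big_fset_incl _ sub) // => y _ /mcoeff_outdom ->.
by rewrite mulr0z.
Qed.

Fact linear_ext_is_zmod_morphism : zmod_morphism linear_ext.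
Proof.
move=> u v; pose D := (msupp u `|` msupp v)%fset.
rewrite (@linear_extEw D u) ?fsubsetUl // (@linear_extEw D v) ?fsubsetUr //.
rewrite (@linear_extEw D (u - v)) ?msuppB_le // -sumrB.
by apply: eq_bigr => y _; rewrite mcoeffB mulrzBr.
Qed.

HB.instance Definition _ := GRing.isZmodMorphism.Build
  {malg int[Y]} W linear_ext linear_ext_is_zmod_morphism.

Lemma linear_extU y : linear_ext << 1 *g y >> = rho y.
Proof.
by rewrite (linear_extEw msuppU_le) big_seq_fset1 mcoeffUU mulr1z.
Qed.

End LinearExtension.

Section PermutationModule.
Variables (B : groupType) (X : choiceType) (a : leftAction B X).

Fact malg_act_is_zmod_morphism (A : zmodType) b : zmod_morphism (@malg_act A B X a b).
Proof. by move=> u v; rewrite malg_actD malg_actN. Qed.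

HB.instance Definition _ (A : zmodType) b := GRing.isZmodMorphism.Build
  {malg A[X]} {malg A[X]} (@malg_act A B X a b) (@malg_act_is_zmod_morphism A b).

Lemma malg_actU (A : zmodType) b x (c : A) :
  malg_act a b << c *g x >> = << c *g a b x >>.
Proof.
apply/malgP => y; rewrite malg_actE !mcoeffU; congr (_ *+ nat_of_bool _).
by apply/eqP/eqP => [->|<-]; rewrite ?lactKV ?lactK.
Qed.

Lemma dot_act b (u v : {malg int[X]}) :
  dot (malg_act a b u) v = dot u (malg_act a b^-1%g v).
Proof.
rewrite dotC [RHS]dotC.
apply: (eq_additive_malg (S := dot v \o malg_act a b)
                         (T := dot (malg_act a b^-1%g v))) => x /=.
by rewrite malg_actU !(dotC _ << _ *g _ >>) !dotUl malg_actE invgK.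
Qed.

Lemma norm1_act b (u : {malg int[X]}) : norm1 (malg_act a b u) = norm1 u.
Proof.
have E : msupp (malg_act a b u) = [fset a b x | x in msupp u]%fset.
  apply/fsetP => x; rewrite -mcoeff_neq0 malg_actE mcoeff_neq0.
  apply/idP/imfsetP => [xu|[y /= yu ->]]; last by rewrite lactK.
  by exists (a b^-1%g x); rewrite ?lactKV.
rewrite /norm1 E big_imfset /=; last by move=> x y _ _; apply: (can_inj (lactK a b)).
by apply: eq_bigr => x _; rewrite malg_actE lactK.
Qed.

End PermutationModule.

Definition equivariant (B : groupType) (X Y : choiceType)
    (aX : leftAction B X) (aY : leftAction B Y)
    (T : {malg int[X]} -> {malg int[Y]}) : Prop :=
  forall b u, T (malg_act aX b u) = malg_act aY b (T u).

(** For equivariant S the diagonal coefficient is constant on orbits, so the choice of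
    representatives is immaterial. For B acting regularly on itself this is the Kaplansky trace on
    Z[B]. *)
Definition trace (X : choiceType) (I : {fset X})
    (S : {malg int[X]} -> {malg int[X]}) : int :=
  \sum_(x <- I) (S << 1 *g x >>)@_x.

Section Transpose.
Local Open Scope classical_set_scope.
Variables (B : groupType) (X Y : choiceType).
Variables (aX : leftAction B X) (aY : leftAction B Y).
Variable T : {additive {malg int[X]} -> {malg int[Y]}}.
Hypothesis Teq : equivariant aX aY T.

Lemma equivariant_coef b x y :
  (T << 1 *g aX b x >>)@_(aY b y) = (T << 1 *g x >>)@_y.
Proof. by rewrite -malg_actU Teq malg_actE lactK. Qed.

(** A nonzero entry (x, y) is a translate of some (i, y') with i in [I] and y' in the support of T
    i, which leaves finitely many pairs. Each contributes to row y at most a translate of Stab(y')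
    i, as large as Stab(i) y', and the latter lies in the support of T i. *)
Lemma finite_rows (I : {fset X}) y : unimodular aX aY -> transversal aX I ->
  finite_set [set x | (T << 1 *g x >>)@_y != 0].
Proof.
move=> uni [Iex _].
apply: (@sub_finite_set _ _ (\bigcup_(i in [set` I])
    \bigcup_(y' in [set` msupp (T << 1 *g i >>)]) [set x | same_orbit2 aX aY x y i y'])).
  move=> x /= Txy; have [i iI [b bx]] := Iex x.
  exists i => //; exists (aY b^-1%g y).
    by rewrite /= -mcoeff_neq0 -(equivariant_coef b) bx lactKV.
  by apply/asboolP; exists b; rewrite lactKV.
apply: bigcup_finite => [|i iI]; first exact: finite_fset.
apply: bigcup_finite => [|y' y'T]; first exact: finite_fset.
have [[b0 b0y]|nb] := pselect (exists b, aY b y' = y); last first.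
  apply: (@sub_finite_set _ _ set0) => // x /asboolP[b [_ by']].
  by case: nb; exists b.
apply: (@sub_finite_set _ _ (aX b0 @` stab_orbit aY aX y' i)).
  move=> x /asboolP[b [bx by']]; exists (aX b0^-1%g x); last by rewrite lactKV.
  exists (b0^-1 * b)%g; last by rewrite lactM bx.
  by rewrite /act_stab /= lactM by' -b0y lactK.
apply: finite_image; have fin : finite_set (stab_orbit aX aY i y').
  apply: (@sub_finite_set _ _ [set` msupp (T << 1 *g i >>)]); last exact: finite_fset.
  move=> _ [b bi <-]; rewrite /= -mcoeff_neq0 -[i]bi equivariant_coef mcoeff_neq0.
  exact: y'T.
by rewrite -(eq_finite_set (uni _ _ fin)).
Qed.

(** By [finite_rows], row y of the matrix of T is an element of Z[X]; it serves as the image of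
    y. *)
Lemma exists_transpose (I : {fset X}) : unimodular aX aY -> transversal aX I ->
  exists Tt : {additive {malg int[Y]} -> {malg int[X]}},
    forall u w, dot (T u) w = dot u (Tt w).
Proof.
move=> uni IX.
have /choice[rho rhoE] : forall y, exists r : {malg int[X]},
    forall x, r@_x = (T << 1 *g x >>)@_y.
  move=> y; have fin := finite_rows y uni IX.
  exists (\sum_(x <- fset_set [set x | (T << 1 *g x >>)@_y != 0])
             << (T << 1 *g x >>)@_y *g x >>).
  move=> x; rewrite raddf_sum /=; under eq_bigr do rewrite mcoeffU.
  have [xy|xy] := eqVneq (T << 1 *g x >>)@_y 0.
    rewrite big1 // => x' _; case: eqVneq => [->|_]; rewrite ?xy ?mul0rn //.
  rewrite (big_fsetD1 x) /= ?in_fset_set ?inE // eqxx big1_fset ?addr0 // => x'.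
  by rewrite !inE => /andP[/negPf ->].
exists (linear_ext rho) => u w.
rewrite dotC [RHS]dotC.
apply: (eq_additive_malg (S := dot w \o T) (T := dot (linear_ext rho w))) => x /=.
rewrite dotC [RHS]dotC.
apply: (eq_additive_malg (S := dot (T << 1 *g x >>))
                         (T := dot << 1 *g x >> \o linear_ext rho)) => y /=.
by rewrite linear_extU dotUl rhoE dotC dotUl.
Qed.

Lemma transpose_equivariant (Tt : {malg int[Y]} -> {malg int[X]}) :
  (forall u w, dot (T u) w = dot u (Tt w)) -> equivariant aY aX Tt.
Proof.
move=> Tadj b w; apply/malgP => x.
rewrite -dotUl -Tadj -{1}[b]invgK -dot_act -Teq Tadj.
by rewrite malg_actU dotUl malg_actE.
Qed.

End Transpose.

(** Both traces sum the B-invariant function S_yx R_xy, one over orbit representatives x, the other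
    over representatives y; [mass_transport] exchanges them. *)
Lemma trace_comm (B : groupType) (X Y : choiceType)
    (aX : leftAction B X) (aY : leftAction B Y) (I : {fset X}) (J : {fset Y})
    (S : {additive {malg int[X]} -> {malg int[Y]}})
    (R : {additive {malg int[Y]} -> {malg int[X]}}) :
  unimodular aX aY -> transversal aX I -> transversal aY J ->
  equivariant aX aY S -> equivariant aY aX R ->
  trace I (R \o S) = trace J (S \o R).
Proof.
move=> uni IX JY Seq Req.
pose f x y := (S << 1 *g x >>)@_y * (R << 1 *g y >>)@_x.
have RS x : (R (S << 1 *g x >>))@_x = \sum_(y <- msupp (S << 1 *g x >>)) f x y.
  rewrite (additive_malgE R) raddf_sum; apply: eq_bigr => y _ /=.
  by rewrite raddfMz /f -mulrzr intz mulrC.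
have SR y : (S (R << 1 *g y >>))@_y = \sum_(x <- msupp (R << 1 *g y >>)) f x y.
  rewrite (additive_malgE S) raddf_sum; apply: eq_bigr => x _ /=.
  by rewrite raddfMz /f -mulrzr intz mulrC.
rewrite /trace; under eq_bigr do rewrite /= RS.
under [RHS]eq_bigr do rewrite /= SR.
apply: mass_transport uni IX JY _ _ => [b x y|x y].
  by rewrite /f (equivariant_coef Seq) (equivariant_coef Req).
by rewrite /f mulf_eq0 negb_or !mcoeff_neq0 => /andP[].
Qed.

(** * Surjective equivariant maps are injective *)

(* (C^m - Q^m) / (C - Q) for Q = shifted C S; since T^t (T T^t) = (T^t T) T^t, the
   same polynomial serves both T^t T and T T^t below. *)
Fixpoint shifted_quot (V : zmodType) (C : nat) (S : V -> V) (m : nat) (w : V) : V :=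
  if m is m'.+1 then w *+ C ^ m' + shifted C S (shifted_quot C S m' w) else 0.

Section ShiftedQuot.
Variables (V : zmodType) (C : nat) (S : {additive V -> V}).

Fact shifted_quot_is_zmod_morphism m : zmod_morphism (shifted_quot C S m).
Proof.
elim: m => [|m IH] u v /=; first by rewrite subrr.
by rewrite IH raddfB mulrnBl [in RHS]opprD addrACA.
Qed.

HB.instance Definition _ m := GRing.isZmodMorphism.Build V V
  (shifted_quot C S m) (shifted_quot_is_zmod_morphism m).

Lemma iter_shifted_quot m w :
  iter m (shifted C S) w = w *+ C ^ m - S (shifted_quot C S m w).
Proof.
elim: m => [|m IH]; first by rewrite expn0 raddf0 subr0.
rewrite iterS IH /= !shiftedE !(raddfB, raddfD, raddfMn) /=.
rewrite mulrnBl -mulrnA -expnSr -!addrA !mulNrn; congr (_ + _).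
by rewrite addrCA.
Qed.

End ShiftedQuot.

(** Isolating the factor T on the right writes the power as C^m - R T, a form to which [trace_comm]
    applies. *)
Lemma iter_shifted_comp (V W : zmodType) (C : nat)
    (T : {additive V -> W}) (Tt : {additive W -> V}) m u :
  iter m (shifted C (Tt \o T)) u =
    u *+ C ^ m - Tt (shifted_quot C (T \o Tt) m (T u)).
Proof.
elim: m => [|m IH]; first by rewrite expn0 raddf0 subr0.
rewrite iterS IH /= !shiftedE !(raddfB, raddfD, raddfMn) /=.
rewrite mulrnBl -mulrnA -expnSr -!addrA !mulNrn; congr (_ + _).
by rewrite addrCA.
Qed.

Section Equivariance.
Variables (B : groupType) (X Y Z : choiceType).
Variables (aX : leftAction B X) (aY : leftAction B Y) (aZ : leftAction B Z).

Lemma equivariant_comp (S : {malg int[Y]} -> {malg int[Z]})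
    (T : {malg int[X]} -> {malg int[Y]}) :
  equivariant aY aZ S -> equivariant aX aY T -> equivariant aX aZ (S \o T).
Proof. by move=> SE TE b u /=; rewrite TE SE. Qed.

Lemma equivariant_shifted C (S : {malg int[X]} -> {malg int[X]}) :
  equivariant aX aX S -> equivariant aX aX (shifted C S).
Proof. by move=> SE b u; rewrite /shifted SE raddfB raddfMn. Qed.

Lemma equivariant_shifted_quot C (S : {malg int[X]} -> {malg int[X]}) m :
  equivariant aX aX S -> equivariant aX aX (shifted_quot C S m).
Proof.
move=> SE; elim: m => [|m IH] b u /=; first by rewrite raddf0.
by rewrite IH equivariant_shifted // [in RHS]malg_actD raddfMn.
Qed.

End Equivariance.

(** By equivariance the norm is constant on orbits, so its sum over representatives is a bound; the
    successor makes C positive. *)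
Lemma bounded_norm1 (B : groupType) (X : choiceType) (a : leftAction B X)
    (I : {fset X}) (S : {additive {malg int[X]} -> {malg int[X]}}) :
  transversal a I -> equivariant a a S ->
  exists2 C, (0 < C)%N & forall x, norm1 (S << 1 *g x >>) <= C%:R.
Proof.
move=> [Iex _] SE; exists (\sum_(i <- I) `|norm1 (S << 1 *g i >>)|%N).+1 => // x.
have [i iI [b <-]] := Iex x; rewrite -malg_actU SE norm1_act.
rewrite (big_fsetD1 i) //= natz; lia.
Qed.

Section SurjectiveInjective.
Variables (B : groupType) (X Y : choiceType).
Variables (aX : leftAction B X) (aY : leftAction B Y).
Variables (I : {fset X}) (J : {fset Y}).
Variable T : {additive {malg int[X]} -> {malg int[Y]}}.
Hypotheses (uni : unimodular aX aY) (IX : transversal aX I) (JY : transversal aY J).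
Hypotheses (IJ : #|` I| = #|` J|) (Teq : equivariant aX aY T).
Hypothesis Tsurj : forall w, exists u, T u = w.

(** The powers are C^m - R T and C^m - T R: the scalar parts agree because [I] and [J] have equal
    size, the others by [trace_comm]. *)
Lemma trace_iter_shifted C (Tt : {additive {malg int[Y]} -> {malg int[X]}}) m :
  equivariant aY aX Tt ->
  trace I (iter m (shifted C (Tt \o T))) = trace J (iter m (shifted C (T \o Tt))).
Proof.
move=> Tteq; pose R := Tt \o shifted_quot C (T \o Tt) m.
have R_eq : equivariant aY aX R.
  apply: equivariant_comp => //; apply: equivariant_shifted_quot.
  exact: equivariant_comp Tteq.
have trX : trace I (iter m (shifted C (Tt \o T))) =
    (#|` I|)%:R *+ C ^ m - trace I (R \o T).
  rewrite /trace -sum1_size natr_sum -sumrMnl -sumrB; apply: eq_bigr => x _.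
  by rewrite iter_shifted_comp mcoeffB mcoeffMn mcoeffUU.
have trY : trace J (iter m (shifted C (T \o Tt))) =
    (#|` J|)%:R *+ C ^ m - trace J (T \o R).
  rewrite /trace -sum1_size natr_sum -sumrMnl -sumrB; apply: eq_bigr => y _.
  by rewrite iter_shifted_quot mcoeffB mcoeffMn mcoeffUU.
by rewrite trX trY IJ (trace_comm uni IX JY Teq R_eq).
Qed.

Lemma equivariant_surj_inj : injective T.
Proof.
have [Tt Tadj] := exists_transpose Teq uni IX.
have Tteq := transpose_equivariant Teq Tadj.
pose S := Tt \o T; pose S' := T \o Tt.
have Sadj u v : dot (S u) v = dot u (S v).
  by rewrite dotC /= -Tadj dotC Tadj.
have Seq : equivariant aX aX S := equivariant_comp Tteq Teq.
have [C C0 normC] := bounded_norm1 IX Seq.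
have S_le u : dot (S u) u <= dot u u *+ C by apply: dot_le_norm1.
pose P := shifted C S; pose Q := shifted C S'.
have QT k u : iter k Q (T u) = T (iter k P u).
  elim: k => //= k ->; rewrite /Q /P /shifted raddfB raddfMn //.
have [h hT] := choice Tsurj.
pose K := \sum_(y <- J) dot (h << 1 *g y >>) (h << 1 *g y >>).
(* With w = h y, so that T w = y, the diagonal coefficient of Q^2k at y equals that of S P^2k
   against w, and [dot_iter_shifted_le] applies. *)
have trQ k : trace J (iter k.*2 Q) *+ k.*2 <= K *+ C ^ k.*2.+1.
  rewrite /trace /K -!sumrMnl; apply: ler_sum => y _.
  rewrite -dotUl -{1 2}(hT << 1 *g y >>) QT Tadj dotC.
  exact: (dot_iter_shifted_le Sadj S_le).
apply: raddf_inj => u Tu0; apply/eqP; apply: contraT => u0.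
have [x ux] : exists x, u@_x != 0.
  apply: contrapT => H; case/eqP: u0; apply/malgP => x; rewrite mcoeff0.
  by apply: contrapT => /eqP ux; apply: H; exists x.
have [i iI [b bi]] := IX.1 x.
(* After translating, the kernel vector is nonzero at i. *)
pose v := malg_act aX b^-1%g u.
have vi : v@_i != 0 by rewrite malg_actE invgK bi.
have Sv n : S (v *+ n) = 0 by rewrite /S /= 2!raddfMn Teq Tu0 !raddf0 mul0rn.
have Pv k : iter k P v = v *+ C ^ k.
  elim: k => // k IH; rewrite iterS IH [P _]shiftedE Sv.
  by rewrite subr0 -mulrnA -expnSr.
(* The product of P^k i with v is C^k v_i, and |v_i| >= 1 as it is a nonzero integer. Cauchy-Schwarz
   bounds its square by |v|^2 |P^k i|^2, where |P^k i|^2 is one of the non-negative terms of tr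
   P^2k. *)
have trP k : (C ^ k.*2)%:R <= dot v v * trace I (iter k.*2 P).
  have le1 : (C ^ k)%:R ^+ 2 <= (dot (iter k P << 1 *g i >>) v) ^+ 2 :> int.
    rewrite (iter_shifted_adj C Sadj) Pv dotUl mcoeffMn.
    rewrite -[in leRHS]mulr_natr exprMn.
    rewrite ler_peMl ?sqr_ge0 //; move: vi; nia.
  rewrite -mul2n mulnC expnM natrX; apply: le_trans le1 _.
  apply: le_trans (dot_CauchySchwarz _ _) _.
  rewrite mulrC ler_wpM2l ?dot_ge0 // /trace (big_fsetD1 i) //=.
  rewrite mulnC mul2n -dotUl dotC (iter_shifted_double C Sadj) lerDl.
  apply: sumr_ge0 => y _.
  by rewrite -dotUl dotC (iter_shifted_double C Sadj) dot_ge0.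
(* Multiply by C^2k and chain [trP], the equality of traces and [trQ], using k <= 2k. *)
have main k : (k%:R : int) <= dot v v * K *+ C.
  have C2 : 0 < (C ^ k.*2)%:R :> int by rewrite ltr0n expn_gt0 C0.
  rewrite -(ler_pM2r C2).
  apply: le_trans (_ : (C ^ k.*2)%:R *+ k.*2 <= _).
    rewrite -[leRHS]mulr_natl ler_wpM2r ?ler_nat -?addnn ?leq_addr //; exact: ltW.
  apply: le_trans (_ : dot v v * (trace J (iter k.*2 Q) *+ k.*2) <= _).
    by rewrite -trace_iter_shifted // mulrnAr lerMn2r trP orbT.
  rewrite mulr_natr -mulrnA -mulrnAr ler_wpM2l ?dot_ge0 // -expnS.
  exact: trQ.
have := main (`|dot v v * K *+ C|%N).+1.
by rewrite natz; lia.
Qed.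

End SurjectiveInjective.

(** * Group morphisms and the Hopf property *)

Section Hopf.
Local Open Scope group_scope.

Section GroupMorphism.
Variables (G H : groupType) (f : {multiplicative G -> H}).

Lemma groupmorph1 : f 1 = 1.
Proof. by apply: (mulgI (f 1)); rewrite -gmulfM !mulg1. Qed.

Lemma groupmorphV x : f x^-1 = (f x)^-1.
Proof. by apply: (mulgI (f x)); rewrite -gmulfM !mulgV groupmorph1. Qed.

Lemma groupmorph_inj : (forall x, f x = 1 -> x = 1) -> injective f.
Proof.
move=> f1 x y fxy; have : x^-1 * y = 1.
  by apply: f1; rewrite gmulfM groupmorphV fxy mulVg.
by move=> /(canRL (mulKg _)); rewrite invgK mulg1.
Qed.

End GroupMorphism.

Section HopfianEndomorphism.
Local Open Scope quotient_scope.
Variables (G H : groupType) (f : {multiplicative G -> H}).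

(** Transparent, so that membership reduces to [f u = 1]. *)
Definition kernel : normalSubgroup G.
Proof.
exists [set u | f u = 1]%classic => /=.
- by rewrite groupmorph1.
- by move=> u v fu fv; rewrite gmulfM fu fv mulg1.
- by move=> u fu; rewrite groupmorphV fu invg1.
- by move=> g u fu; rewrite !gmulfM fu mulg1 groupmorphV mulgV.
Defined.

Definition quotient_map (a : quotient_group kernel) : H := f (repr a).

Lemma quotient_map_pi g : quotient_map (\pi_(quotient_group kernel) g) = f g.
Proof.
have /asboolP /= := repr_cosetrel kernel g.
by rewrite gmulfM groupmorphV => /(canRL (mulKg _)); rewrite invgK mulg1.
Qed.

Fact quotient_mapM : {morph quotient_map : a b / a * b}.
Proof.
move=> a b; rewrite -[a]reprK -[b]reprK.
rewrite [_ * _ in LHS](pi_qmul kernel) !quotient_map_pi.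
exact: gmulfM.
Qed.

HB.instance Definition _ :=
  monoid.isMultiplicative.Build (quotient_group kernel) H quotient_map quotient_mapM.

Lemma quotient_map_inj : injective quotient_map.
Proof.
move=> a b; rewrite -[a]reprK -[b]reprK !quotient_map_pi => E.
by apply/qpiP/asboolP => /=; rewrite gmulfM groupmorphV E mulVg.
Qed.

End HopfianEndomorphism.

Lemma inj_surj_bijective (T U : Type) (f : T -> U) :
  injective f -> (forall y, exists x, f x = y) -> bijective f.
Proof.
move=> finj /choice[g gK]; exists g => // x.
by apply: finj; rewrite gK.
Qed.

(** A surjective f identifies G / ker f with G; conversely, an isomorphism from G / N to G composed
    with the projection is a surjective endomorphism that kills N. *)
Lemma hopfianP (G : groupType) :
  hopfian G <-> forall f : {multiplicative G -> G},
    (forall y, exists x, f x = y) -> injective f.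
Proof.
split=> [hop f fsurj | hop N [f [g fK gK]]].
  have iso : isomorphic (quotient_group (kernel f)) G.
    exists (quotient_map (f := f)); apply: inj_surj_bijective.
      exact: quotient_map_inj.
    by move=> y; have [x <-] := fsurj y; exists (\pi_(quotient_group (kernel f))%qT x);
       apply: quotient_map_pi.
  apply: groupmorph_inj => x fx.
  by have : nsub_set (kernel f) x by []; rewrite (hop _ iso).
pose p (x : G) : quotient_group N := \pi_(quotient_group N)%qT x.
have pM : {morph p : x y / x * y} by move=> x y; rewrite /p -pi_qmul.
pose pm := monoid.isMultiplicative.Build _ _ p pM.
pose pf : {multiplicative G -> quotient_group N} := HB.pack p pm.
have inj : injective (f \o pf).
  apply: hop => y; exists (repr (g y)).
  by rewrite /= /p reprK gK.
apply/seteqP; split=> [x Nx|_ ->]; last exact: nsub1.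
apply: inj; rewrite /= (_ : p x = p 1) //.
by apply/esym/qpiP/asboolP; rewrite invg1 mul1g.
Qed.

End Hopf.

(** * Orbits, indices and twisted actions *)

Section Actions.
Local Open Scope classical_set_scope.
Local Open Scope group_scope.
Variables (B : groupType) (X Y : choiceType).
Variables (aX : leftAction B X) (aY : leftAction B Y).

(* A coset is determined by the point to which it moves y. *)
Lemma left_cosets_stab_orbit x y :
  (left_cosets (act_stab aX x) (act_stab aX x `&` act_stab aY y)
    #= stab_orbit aX aY x y)%card.
Proof.
pose F y' : set B := [set h | act_stab aX x h /\ aY h y = y'].
have FE h : act_stab aX x h ->
    F (aY h y) = [set h * k | k in act_stab aX x `&` act_stab aY y].
  move=> hx; apply/seteqP; split=> [h' [h'x h'y]|_ [k [kx ky] <-]].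
    exists (h^-1 * h'); last by rewrite mulgA mulgV mul1g.
    split; first by rewrite /act_stab /= lactM h'x -{1}hx lactK.
    by rewrite /act_stab /= lactM h'y lactK.
  by split; rewrite /act_stab /= lactM ?kx ?ky.
have -> : left_cosets (act_stab aX x) (act_stab aX x `&` act_stab aY y) =
    F @` stab_orbit aX aY x y.
  apply/seteqP; split=> [_ [h hx <-]|_ [_ [h hx <-] <-]].
    by exists (aY h y); [exists h | rewrite FE].
  by exists h => //; rewrite FE.
apply: inj_card_eq => y1 y2; rewrite !inE => -[h hx <-] _ E.
have : F (aY h y) h by split.
by rewrite E => -[].
Qed.

End Actions.

(** Indices are sizes of stabilizer orbits; when one is finite, equality with a [Some] forces the
    other to be finite. *)
Lemma eq_index_unimodular (B : groupType) (X Y : choiceType)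
    (aX : leftAction B X) (aY : leftAction B Y) :
  (forall x y,
     subgroup_index (act_stab aX x) (act_stab aX x `&` act_stab aY y)%classic
     = subgroup_index (act_stab aY y) (act_stab aX x `&` act_stab aY y)%classic) ->
  unimodular aX aY.
Proof.
move=> idx x y fin.
have cX := left_cosets_stab_orbit aX aY x y.
have := left_cosets_stab_orbit aY aX y x; rewrite setIC => cY.
move: (idx x y); rewrite /subgroup_index.
case: pselect => [finX|]; last by rewrite (eq_finite_set cX).
case: pselect => // finY [/(fcard_eq finX finY) E].
by rewrite -(card_eql cX) (card_eql E).
Qed.

Section Orbits.
Local Open Scope classical_set_scope.
Local Open Scope group_scope.
Variables (B : groupType) (X : choiceType) (a : leftAction B X).

Lemma exists_transversal : finitely_many_orbits a ->
  exists I, transversal a I.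
Proof.
(* [xget] needs a default point, hence the separate case of empty X. *)
move=> fin; have [[x0 _]|noX] := pselect (exists x0 : X, True); last first.
  by exists fset0; split=> x; [case: noX; exists x | rewrite in_fset0].
pose orbits : set (set X) := [set act_orbit a x | x in setT].
have orbitE x i : act_orbit a x i -> act_orbit a i = act_orbit a x.
  move=> [b _ <-]; apply/seteqP; split=> _ [c _ <-].
    by exists (c * b); rewrite ?lactM.
  by exists (c * b^-1); rewrite // lactM lactK.
have repE S : orbits S -> act_orbit a (xget x0 S) = S.
  move=> [x _ <-]; apply: orbitE; apply: (xgetI x0 (x := x)).
  by exists 1; rewrite ?lact1.
exists [fset xget x0 S | S in fset_set orbits]%fset; split=> [x|].
  have Ox : orbits (act_orbit a x) by exists x.
  exists (xget x0 (act_orbit a x)).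
    by apply/imfsetP; exists (act_orbit a x); rewrite //= in_fset_set // inE.
  have : act_orbit a (xget x0 (act_orbit a x)) x.
    by rewrite repE //; exists 1; rewrite ?lact1.
  by move=> [b _ bx]; exists b.
move=> _ _ /imfsetP[S /= SO ->] /imfsetP[S' /= SO' ->] [b bS].
move: SO SO'; rewrite !in_fset_set // !inE => SO SO'.
congr xget; rewrite -(repE _ SO) -(repE _ SO').
by apply/esym/orbitE; exists b.
Qed.

Fact prod_act_is_left_action (J : Type) :
  is_left_action (fun b (z : X * J) => (a b z.1, z.2)).
Proof.
by split=> [[x j]|b c [x j]] /=; rewrite ?lact1 ?lactM.
Qed.

(** For J = 'I_n this makes Z^n[X] the permutation module Z[X x n]. *)
Definition prod_act (J : Type) : leftAction B (X * J)%type :=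
  LeftAction (prod_act_is_left_action J).

Lemma transversal_prod (I : {fset X}) (J : finType) : transversal a I ->
  transversal (prod_act J) (I `*` [fset j | j in J])%fset.
Proof.
move=> [Iex Iuniq]; split=> [[x j]|[i j] [i' j']].
  have [i iI [b bi]] := Iex x; exists (i, j); last by exists b; rewrite /= bi.
  by rewrite in_fsetM iI; apply/imfsetP; exists j.
by rewrite !in_fsetM => /andP[/= iI _] /andP[/= i'I _] [b [bi ->]];
   congr pair; apply: Iuniq => //; exists b.
Qed.

Variable s : {multiplicative B -> B}.

Fact twist_act_is_left_action : is_left_action (fun b => a (s b)).
Proof. by split=> [x|b c x]; rewrite ?groupmorph1 ?lact1 ?gmulfM ?lactM. Qed.

(** Twisting the target turns T (b m) = sigma(b) T m into plain equivariance. *)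
Definition twist_act : leftAction B X := LeftAction twist_act_is_left_action.

(** A surjective twist leaves the orbits unchanged. *)
Lemma transversal_twist (I : {fset X}) : (forall c, exists b, s b = c) ->
  transversal a I -> transversal twist_act I.
Proof.
move=> ssurj [Iex Iuniq]; split=> [x|i i' iI i'I [b bi]].
  have [i iI [b bi]] := Iex x; have [c cb] := ssurj b.
  by exists i => //; exists c; rewrite /= cb.
by apply: Iuniq => //; exists (s b).
Qed.

End Orbits.

(** Stabilizers ignore the second coordinate, and orbits stay in one slice. *)
Lemma unimodular_prod (B : groupType) (X Y : choiceType) (I J : choiceType)
    (aX : leftAction B X) (aY : leftAction B Y) :
  unimodular aX aY -> unimodular (prod_act aX I) (prod_act aY J).
Proof.
have stabE (X' Y' I' J' : choiceType) (aX' : leftAction B X') (aY' : leftAction B Y') z w :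
    (stab_orbit (prod_act aX' I') (prod_act aY' J') z w
      #= stab_orbit aX' aY' z.1 w.1)%card.
  rewrite (_ : stab_orbit _ _ z w =
    [set (y, w.2) | y in stab_orbit aX' aY' z.1 w.1])%classic; last first.
    apply/seteqP; split=> [_ [b bz <-]|_ [_ [b bz <-] <-]].
      exists (aY' b w.1) => //; exists b => //.
      by case: z bz => x i; rewrite /act_stab /= => -[].
    by exists b => //; case: z bz => x i; rewrite /act_stab /= => ->.
  by apply: inj_card_eq => y y' _ _ [].
move=> uni z w fin; rewrite (card_eql (stabE _ _ _ _ _ _ _ _)).
rewrite (card_eqr (stabE _ _ _ _ _ _ _ _)); apply: uni.
by rewrite -(eq_finite_set (stabE _ _ _ _ _ _ _ _)).
Qed.

(** * Functions from X to Z^n as integer functions on X x n *)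

Section Currying.
Variables (X : choiceType) (n : nat).
Local Open Scope ring_scope.

Definition curry_malg (u : {malg int[(X * 'I_n)%type]}) : {malg 'rV[int]_n[X]} :=
  \sum_(z <- msupp u) << u@_z *: delta_mx 0 z.2 *g z.1 >>.

Definition uncurry_malg (m : {malg 'rV[int]_n[X]}) : {malg int[(X * 'I_n)%type]} :=
  \sum_(x <- msupp m) \sum_j << m@_x 0 j *g (x, j) >>.

Lemma curry_malgE u x j : (curry_malg u)@_x 0 j = u@_(x, j).
Proof.
rewrite /curry_malg raddf_sum summxE /=.
under eq_bigr do rewrite mcoeffU.
have [xu|xu] := boolP ((x, j) \in msupp u).
  rewrite (big_fsetD1 _ xu) /= eqxx mulr1n !mxE !eqxx mulr1 big1_fset ?addr0 //.
  move=> [y k]; rewrite !inE => /andP[/= yk _] _.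
  have [yx|_] := eqVneq y x; last by rewrite mulr0n mxE.
  rewrite mulr1n !mxE; have [kj|_] := eqVneq j k; last by rewrite andbF mulr0.
  by rewrite yx kj eqxx in yk.
rewrite (mcoeff_outdom xu) big1_fset // => -[y k] yku _ /=.
have [yx|_] := eqVneq y x; last by rewrite mulr0n mxE.
rewrite mulr1n !mxE; have [kj|_] := eqVneq j k; last by rewrite andbF mulr0.
by rewrite -yx kj yku in xu.
Qed.

Lemma uncurry_malgE m x j : (uncurry_malg m)@_(x, j) = m@_x 0 j.
Proof.
rewrite /uncurry_malg raddf_sum /=.
have E y : (\sum_k << m@_y 0 k *g (y, k) >>)@_(x, j) = m@_y 0 j *+ (y == x).
  rewrite raddf_sum (bigD1 j) //= mcoeffU xpair_eqE eqxx andbT big1 ?addr0 // => k kj.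
  by rewrite mcoeffU xpair_eqE (negPf kj) andbF.
under eq_bigr do rewrite E.
have [xm|xm] := boolP (x \in msupp m).
  rewrite (big_fsetD1 _ xm) /= eqxx mulr1n big1_fset ?addr0 // => y.
  by rewrite !inE => /andP[/negPf ->].
rewrite (mcoeff_outdom xm) mxE big1_fset // => y ym _.
by case: eqVneq => // yx; rewrite -yx ym in xm.
Qed.

Lemma curry_malgK : cancel curry_malg uncurry_malg.
Proof. by move=> u; apply/malgP => -[x j]; rewrite uncurry_malgE curry_malgE. Qed.

Lemma uncurry_malgK : cancel uncurry_malg curry_malg.
Proof.
by move=> m; apply/malgP => x; apply/rowP => j; rewrite curry_malgE uncurry_malgE.
Qed.

Fact curry_malg_is_zmod_morphism : zmod_morphism curry_malg.
Proof.
move=> u v; apply/malgP => x; apply/rowP => j.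
by rewrite mcoeffB !mxE !curry_malgE mcoeffB.
Qed.

HB.instance Definition _ :=
  GRing.isZmodMorphism.Build _ _ curry_malg curry_malg_is_zmod_morphism.

Fact uncurry_malg_is_zmod_morphism : zmod_morphism uncurry_malg.
Proof.
move=> u v; apply/malgP => -[x j].
by rewrite mcoeffB !uncurry_malgE mcoeffB !mxE.
Qed.

HB.instance Definition _ :=
  GRing.isZmodMorphism.Build _ _ uncurry_malg uncurry_malg_is_zmod_morphism.

Variables (B : groupType) (a : leftAction B X).

Lemma curry_malg_act b u :
  curry_malg (malg_act (prod_act a 'I_n) b u) = malg_act a b (curry_malg u).
Proof.
by apply/malgP => x; apply/rowP => j; rewrite malg_actE !curry_malgE malg_actE.
Qed.

Lemma uncurry_malg_act b m :
  uncurry_malg (malg_act a b m) = malg_act (prod_act a 'I_n) b (uncurry_malg m).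
Proof.
by apply/malgP => -[x j]; rewrite malg_actE !uncurry_malgE malg_actE.
Qed.

End Currying.

(** * Endomorphisms of the wreath product *)

Section Wreath.
Local Open Scope group_scope.
Variables (A : zmodType) (B : groupType) (X : choiceType) (act : leftAction B X).
Local Notation W := (wreath A act).
Implicit Types (g h : W) (m : {malg A[X]}) (b : B).

Lemma wtopM g h : wtop (g * h) = wtop g * wtop h. Proof. by []. Qed.
Lemma wbaseM g h : wbase (g * h) = (wbase g + malg_act act (wtop g) (wbase h))%R.
Proof. by []. Qed.
Lemma wtopV g : wtop g^-1 = (wtop g)^-1. Proof. by []. Qed.
Lemma wbaseV g : wbase g^-1 = (- malg_act act (wtop g)^-1 (wbase g))%R.
Proof. by []. Qed.

Lemma wreath_eq g h : wbase g = wbase h -> wtop g = wtop h -> g = h.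
Proof. by case: g h => [m b] [m' b'] /= -> ->. Qed.

Lemma wreath_factor g : g = (Wreath act (wbase g) 1 : W) * (Wreath act 0%R (wtop g) : W).
Proof.
by apply: wreath_eq; rewrite ?wbaseM ?wtopM /= ?malg_act0 ?addr0 ?mul1g.
Qed.

Lemma wbase_commute g h : wtop g = 1 -> wtop h = 1 -> commute g h.
Proof.
move=> g1 h1; apply: wreath_eq; last by rewrite !wtopM g1 h1.
by rewrite !wbaseM g1 h1 !malg_act1 addrC.
Qed.

Lemma wbaseJ h g : wtop g = 1 -> wbase (h * g * h^-1) = malg_act act (wtop h) (wbase g).
Proof.
move=> g1; rewrite !wbaseM wtopM g1 mulg1 wbaseV malg_actN -malg_actM mulgV malg_act1.
by rewrite addrAC subrr add0r.
Qed.

(* Commuting with its conjugates by M forces (b - 1)^2 = 0 on M, where b is the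
   top component; evaluate this at << a *g x >>. *)
Lemma commute_conj_kernel (a : A) g : (a *+ 2 != 0)%R ->
  (forall m, commute g ((Wreath act m 1 : W) * g * (Wreath act m 1 : W)^-1)) ->
  act_kernel act (wtop g).
Proof.
move=> a2 gC x; apply: contrapT => /eqP bx.
pose m : {malg A[X]} := (<< a *g x >>)%R.
have := congr1 (@wbase _ _ _ _) (gC m).
rewrite !wbaseM !wtopM !wbaseV !wtopV /= !malg_act1 invg1 !mulg1 !mul1g.
rewrite !malg_act1 malg_actN.
set b := wtop g; set u := wbase g.
(* The relation is 2 b m = m + b^2 m; at b x the left side is 2a and the right side is 0, as b x
   differs from x and from b^2 x. *)
rewrite !malg_actD !malg_actN => /(congr1 (mcoeff (act b x))).
rewrite !(mcoeffD, mcoeffN, malg_actU) !mcoeffU eqxx mulr1n.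
rewrite (can_eq (lactK act b)) (negPf bx) eq_sym (negPf bx) !mulr0n.
rewrite add0r subr0 addrCA => /eqP.
rewrite [(a + _)%R]addrA => /eqP/addIr; rewrite addrC => /addrI aN.
by case/eqP: a2; rewrite mulr2n {1}aN addNr.
Qed.

Variable phi : {multiplicative W -> W}.
Hypothesis phi_surj : forall g, exists h, phi h = g.
Hypothesis D_nonabelian : forall b : B, act_kernel act b -> b <> 1 ->
  nonabelian_set (conj_class b).
Variable a : A.
Hypothesis a2 : (a *+ 2 != 0)%R.

(* phi maps M onto an abelian normal subgroup, all of whose elements commute
   with their conjugates. *)
Lemma wtop_endo_base m : wtop (phi (Wreath act m 1)) = 1.
Proof.
set g := phi _.
(* By surjectivity all conjugates of [g] are images of elements of M, and M is abelian. *)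
have gC h h' : commute (h * g * h^-1) (h' * g * h'^-1).
  have [k <-] := phi_surj h; have [k' <-] := phi_surj h'.
  rewrite -!groupmorphV -!gmulfM /commute -!gmulfM; congr (phi _).
  by apply: wbase_commute; rewrite !wtopM wtopV mulg1 mulgV.
have gK : act_kernel act (wtop g).
  apply: commute_conj_kernel a2 _ => m'.
  by have := gC 1 (Wreath act m' 1); rewrite invg1 mul1g mulg1.
(* Two non-commuting conjugates of the top of [g] would lift to non-commuting conjugates of [g]. *)
apply: contrapT => g1; have [_ [_ [[h _ <-] [h' _ <-] []]]] := D_nonabelian gK g1.
exact: (congr1 (@wtop _ _ _ _) (gC (Wreath act 0%R h) (Wreath act 0%R h'))).
Qed.

(** Since phi preserves M, this is the endomorphism sigma induced on B = G/M. *)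
Definition endo_top b : B := wtop (phi (Wreath act 0%R b)).

Lemma wtop_endo g : wtop (phi g) = endo_top (wtop g).
Proof.
by rewrite [g in LHS]wreath_factor gmulfM wtopM wtop_endo_base mul1g.
Qed.

Lemma endo_top1 : endo_top 1 = 1.
Proof. by rewrite /endo_top (groupmorph1 phi). Qed.

Lemma endo_topM : {morph endo_top : b c / b * c}.
Proof.
move=> b c; rewrite /endo_top -wtopM -gmulfM; congr (wtop (phi _)).
by apply: wreath_eq; rewrite // wbaseM /= malg_act0 addr0.
Qed.

Lemma endo_top_surj c : exists b, endo_top b = c.
Proof.
have [g gc] := phi_surj (Wreath act 0%R c).
by exists (wtop g); rewrite -wtop_endo gc.
Qed.

Definition endo_base m : {malg A[X]} := wbase (phi (Wreath act m 1)).

Lemma endo_base_is_zmod_morphism : zmod_morphism endo_base.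
Proof.
have D u v : endo_base (u + v)%R = (endo_base u + endo_base v)%R.
  have -> : endo_base v = malg_act act (wtop (phi (Wreath act u 1))) (endo_base v).
    by rewrite wtop_endo_base malg_act1.
  rewrite /endo_base -wbaseM -gmulfM; congr (wbase (phi _)).
  by apply: wreath_eq; rewrite ?wbaseM ?wtopM /= ?malg_act1 ?mulg1.
by move=> u v; rewrite -[u in RHS](subrK v) [in RHS]D addrK.
Qed.

(** The action of b on M is conjugation in G, which phi respects. *)
Lemma endo_base_act b m :
  endo_base (malg_act act b m) = malg_act act (endo_top b) (endo_base m).
Proof.
rewrite /endo_base -wreath_conjE !gmulfM groupmorphV wbaseJ //.
exact: wtop_endo_base.
Qed.

(** The top of a preimage of an element of M is killed by sigma, so the preimage lies in M. *)
Lemma endo_base_surj : injective endo_top -> forall m, exists m', endo_base m' = m.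
Proof.
move=> top_inj m; have [g gm] := phi_surj (Wreath act m 1).
have g1 : wtop g = 1 by apply: top_inj; rewrite -wtop_endo gm endo_top1.
exists (wbase g); rewrite /endo_base (_ : Wreath act (wbase g) 1 = g) ?gm //.
exact: wreath_eq.
Qed.

Lemma endo_inj : injective endo_top -> injective endo_base -> injective phi.
Proof.
move=> top_inj base_inj; apply: groupmorph_inj => g phig.
have g1 : wtop g = 1 by apply: top_inj; rewrite -wtop_endo phig endo_top1.
apply: wreath_eq => //; apply: base_inj.
rewrite /endo_base (_ : Wreath act (wbase g) 1 = g); last exact: wreath_eq.
by rewrite phig (groupmorph1 phi).
Qed.

End Wreath.

(** The twisted stabilizer of y is the image of Stab(y) under the inverse of s, hence some Stab(z)
    by 3); then 4) applies to x and z. *)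
Lemma unimodular_twist (B : groupType) (X : choiceType) (act : leftAction B X)
    (s : {multiplicative B -> B}) : bijective s ->
  aut_permutes_stabs act ->
  (forall x y : X,
     subgroup_index (act_stab act x) (act_stab act x `&` act_stab act y)%classic
     = subgroup_index (act_stab act y) (act_stab act x `&` act_stab act y)%classic) ->
  unimodular act (twist_act act s).
Proof.
move=> [t sK tK] perm idx; apply: eq_index_unimodular => x y.
pose tm := monoid.isMultiplicative.Build B B t (can2_gmulfM sK tK).
pose t' : {multiplicative B -> B} := HB.pack t tm.
have [z zE] := perm t' (Bijective tK sK) y.
suff -> : act_stab (twist_act act s) y = act_stab act z by [].
rewrite -zE; apply/seteqP; split=> [b by_|_ [c cy <-]].
  by exists (s b); rewrite //= sK.
by rewrite /act_stab /= tK.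
Qed.

Theorem corollaryC (n : nat) (hn : (1 <= n)%N) (B : groupType)
    (X : choiceType) (act : leftAction B X)
    (horb : finitely_many_orbits act)
    (h1 : forall b : B, act_kernel act b -> b <> 1%g ->
            nonabelian_set (conj_class b))
    (h2 : hopfian B)
    (h3 : aut_permutes_stabs act)
    (h4 : forall x y : X,
       subgroup_index (act_stab act x) (act_stab act x `&` act_stab act y)%classic
       = subgroup_index (act_stab act y) (act_stab act x `&` act_stab act y)%classic) :
  hopfian (wreath 'rV[int]_n act).
Proof.
apply/hopfianP => phi phi_surj.
(* As n >= 1, coordinate 0 exists and shows that the double is nonzero. *)
have a2 : (const_mx 1 : 'rV[int]_n) *+ 2 != 0.
  by apply/eqP => /rowP/(_ (Ordinal hn)); rewrite mulr2n !mxE.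
pose s : {multiplicative B -> B} := HB.pack (endo_top phi)
  (monoid.isMultiplicative.Build B B _ (endo_topM phi)).
pose T0 : {additive {malg 'rV[int]_n[X]} -> {malg 'rV[int]_n[X]}} :=
  HB.pack (endo_base phi)
    (GRing.isZmodMorphism.Build _ _ _ (endo_base_is_zmod_morphism phi_surj h1 a2)).
have s_surj : forall c, exists b, s b = c := endo_top_surj phi_surj h1 a2.
have s_inj : injective s by apply: (hopfianP B).1.
have T0_surj := endo_base_surj phi_surj h1 a2 s_inj.
have [I IX] := exists_transversal horb.
have uni := unimodular_twist (inj_surj_bijective s_inj s_surj) h3 h4.
pose T : {additive {malg int[(X * 'I_n)%type]} -> {malg int[(X * 'I_n)%type]}} :=
  @uncurry_malg X n \o T0 \o @curry_malg X n.
have T_inj : injective T.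
  (* The same finite set serves for both actions, so the two transversals have equal size. *)
  have IZ := transversal_prod 'I_n IX.
  have JZ := transversal_prod 'I_n (transversal_twist s_surj IX).
  apply: (equivariant_surj_inj (unimodular_prod uni) IZ JZ) => // [b u|w].
    rewrite /T /= curry_malg_act (endo_base_act phi_surj h1 a2).
    by rewrite -uncurry_malg_act.
  have [m mw] := T0_surj (curry_malg w).
  by exists (uncurry_malg m); rewrite /T /= uncurry_malgK mw curry_malgK.
apply: (endo_inj phi_surj h1 a2 s_inj) => m m' E.
apply: (can_inj (@uncurry_malgK X n)); apply: T_inj.
by rewrite /T /= !uncurry_malgK; congr uncurry_malg.
Qed.
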